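(* Let $\alpha\in\{132,321,213\}$. For $n\ge1$, $$s_n^1(\alpha)=\frac14\sum_{i=0}^{n-1}\left(\frac{-1}{2}\right)^i\left(C_{n-i}+3F_{n-i-1}\right).$$
   Context: $s_n^1(\alpha)$ is the number of permutations $\pi=\pi_1\cdots\pi_n$ of $\{1,\dots,n\}$ avoiding $\alpha$ (no indices $i<j<l$ with $\pi_i\pi_j\pi_l$ order-isomorphic to $\alpha$) with exactly one fixed point. $C_m=\frac1{m+1}\binom{2m}{m}$ is the $m$-th Catalan number. The Fine numbers are $F_0=1$ and $F_m=\sum_{1\le k\le m/2}\left[\binom{2m-2k-1}{m-1}-\binom{2m-2k-1}{m}\right]$ for $m\ge1$, so $F_1=0,F_2=1,F_3=2,F_4=6,\dots$. *)

(* Defs.v *)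
From mathcomp Require Import all_boot all_order all_algebra all_fingroup.

Set Implicit Arguments.
Unset Strict Implicit.
Unset Printing Implicit Defensive.

Import GRing.Theory.

(* Patterns are words over nat in one-line notation, e.g. [:: 1; 3; 2].
   Permutations of {1, ..., n} are elements of 'S_n, with positions and values
   both shifted down by one; this changes neither order-isomorphism of
   subwords nor fixed points. *)

Definition order_iso (s t : seq nat) : bool :=
  (size s == size t) &&
  [forall i : 'I_(size s), forall j : 'I_(size s),
     (nth 0 s i < nth 0 s j) == (nth 0 t i < nth 0 t j)].

Definition avoids3 n (alpha : seq nat) (pi : 'S_n) : bool :=
  ~~ [exists i : 'I_n, exists j : 'I_n, exists l : 'I_n,
        [&& i < j, j < l &
            order_iso [:: (pi i : nat); (pi j : nat); (pi l : nat)] alpha]].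

Definition fixed_points n (pi : 'S_n) : {set 'I_n} := [set i | pi i == i].

Definition num_avoid_fix (n k : nat) (alpha : seq nat) : nat :=
  #|[set pi : 'S_n | avoids3 alpha pi & #|fixed_points pi| == k]|.

Definition catalan (m : nat) : rat :=
  (1 / m.+1%:R * 'C(2 * m, m)%:R)%R.

(* For 1 <= k <= m/2 the truncated nat subtractions below agree with those in
   the integers; the difference of binomials is taken in rat. *)
Definition fine_number (m : nat) : rat :=
  if m == 0 then 1%R
  else (\sum_(1 <= k < m./2.+1)
          ('C(2 * m - 2 * k - 1, m - 1)%:R - 'C(2 * m - 2 * k - 1, m)%:R))%R.

(* Main.v *)
(* Marking a fixed point splits an avoider of 321 or of 132 into a pair of
   avoiders (s, t): the word is t with the block s (+) 1 inserted at a point of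
   the diagonal determined by t, and its fixed points are those of s, the mark,
   and those of t.  Marking the smallest fixed point, respectively the only one,
   gives C = D + x D C and T = x D^2 for the generating functions of all
   avoiders, of those without fixed point and of those with exactly one.  Both
   classes are counted by the Catalan numbers: 132 by splitting at the maximum,
   321 by ballot numbers recording an increasing tail.  As 2 F + x F = C + 1,
   the Fine numbers satisfy the equation of D, whence 2 T_n + T_(n-1) =
   (C_n + 3 F_(n-1)) / 2.  Reverse-complement preserves fixed points and
   exchanges 132 and 213. *)
Require Import Defs.
From mathcomp Require Import all_boot all_order all_algebra all_fingroup.
From mathcomp Require Import zify ring lra.

Set Implicit Arguments.
Unset Strict Implicit.
Unset Printing Implicit Defensive.

Import GRing.Theory Num.Theory.

(** * Catalan, ballot and Fine numbers *)

Section Numbers.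
Local Open Scope ring_scope.

Lemma catalan0 : catalan 0 = 1.
Proof. by rewrite /catalan muln0 bin0. Qed.

(** Absorption leads from binom(2n,n) to binom(2n+1,n+1) and from binom(2n+1,n) to binom(2n+2,n+1);
    the symmetry of row 2n+1 joins the two steps. *)
Lemma catalanS n : n.+2%:R * catalan n.+1 = (4 * n + 2)%:R * catalan n.
Proof.
rewrite /catalan.
have e1 := mul_bin_diag (2 * n).+2 n.
have e2 := mul_bin_diag (2 * n).+1 n.
have e3 : ('C((2 * n).+1, n) = 'C((2 * n).+1, n.+1))%N.
  by rewrite -bin_sub; [congr ('C(_, _)); lia|lia].
have {e1 e2 e3} e : (n.+1 * 'C(2 * n.+1, n.+1) = (4 * n + 2) * 'C(2 * n, n))%N.
  have -> : (2 * n.+1 = (2 * n).+2)%N by lia.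
  have e4 : ((2 * n).+2 = 2 * n.+1)%N by lia.
  rewrite -e1 e3 /= e4.
  have -> : (2 * n.+1 * 'C((2 * n).+1, n.+1) = 2 * (n.+1 * 'C((2 * n).+1, n.+1)))%N by lia.
  rewrite -e2 /=; lia.
have /(congr1 (fun k => k%:R : rat)) := e; rewrite !natrM => {}e.
have h1 : n.+1%:R != 0 :> rat by rewrite pnatr_eq0.
have h2 : n.+2%:R != 0 :> rat by rewrite pnatr_eq0.
apply: (mulfI h1).
rewrite !div1r [in LHS]mulVKf // e; set x := (4 * n + 2)%:R.
by rewrite mulrCA mulVKf.
Qed.

Definition conv (f g : nat -> rat) n := \sum_(i < n.+1) f i * g (n - i)%N.

Lemma convC f g n : conv f g n = conv g f n.
Proof.
rewrite /conv (reindex_inj rev_ord_inj) /=; apply: eq_bigr => i _.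
by rewrite mulrC subSS subKn // -ltnS.
Qed.

(* With S_n the convolution, symmetry gives
   (n+3)/2 S_(n+1) = \sum_i (i+1) C_i C_(n+1-i), and catalanS turns the right
   side into C_(n+1) + (2n+2) S_n. *)
Lemma catalan_conv n : conv catalan catalan n = catalan n.+1.
Proof.
(* The weights i and k - i give the same sum by symmetry, and they add up to k. *)
have sym k : \sum_(i < k.+1) i%:R * (catalan i * catalan (k - i)%N)
    = k%:R / 2%:R * conv catalan catalan k.
  have e : \sum_(i < k.+1) i%:R * (catalan i * catalan (k - i)%N) =
      \sum_(i < k.+1) (k - i)%:R * (catalan i * catalan (k - i)%N).
    rewrite (reindex_inj rev_ord_inj) /=; apply: eq_bigr => i _.
    have hi := ltn_ord i.
    rewrite subSS; have -> : (k - (k - i) = i)%N by lia.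
    by congr (_ * _); rewrite mulrC.
  have : \sum_(i < k.+1) i%:R * (catalan i * catalan (k - i)%N)
      + \sum_(i < k.+1) (k - i)%:R * (catalan i * catalan (k - i)%N)
      = k%:R * conv catalan catalan k.
    rewrite -big_split /conv mulr_sumr; apply: eq_bigr => i _ /=.
    by rewrite -mulrDl -natrD; congr (_%:R * _); have := ltn_ord i; lia.
  rewrite -e => h; lra.
elim: n => [|n IH].
  rewrite /conv big_ord_recl big_ord0 subnn catalan0.
  by have := catalanS 0; rewrite catalan0; lra.
have e1 : \sum_(i < n.+2) (i%:R + 1) * (catalan i * catalan (n.+1 - i)%N)
   = (n.+1%:R / 2%:R + 1) * conv catalan catalan n.+1.
  rewrite mulrDl -sym /conv mul1r -big_split /=.
  by apply: eq_bigr => i _; rewrite mulrDl mul1r.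
have e2 : \sum_(i < n.+2) (i%:R + 1) * (catalan i * catalan (n.+1 - i)%N)
   = catalan n.+1 + (2%:R * n%:R + 2%:R) * conv catalan catalan n.
  rewrite big_ord_recl /= catalan0 subn0 add0r !mul1r; congr (_ + _).
  transitivity (4%:R * (n%:R / 2%:R * conv catalan catalan n)
                + 2%:R * conv catalan catalan n); last by lra.
  rewrite -sym /conv !mulr_sumr -big_split /=; apply: eq_bigr => i _.
  rewrite /bump leq0n add1n subSS natr1 mulrA catalanS natrD natrM; lra.
have := catalanS n.+1; rewrite IH in e2; rewrite e1 in e2.
rewrite natrD natrM -[n.+3%:R]natr1 -[n.+2%:R]natr1 -[n.+1%:R]natr1 in e2 * => h.
have h0 : 0 <= n%:R :> rat by apply: ler0n.
apply: (@mulfI _ (n%:R + 3%:R)); first by apply: lt0r_neq0; lra.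
move: e2 h; set x := conv _ _ _; set y := catalan n.+2; set z := catalan n.+1.
move=> e2 h; lra.
Qed.

(** For j <= n this is the reflection-principle count of lattice paths with n up-steps and n - j
    down-steps that never go below their start. It will count the 321-avoiders of length n whose
    last j entries increase. *)
Definition ballot n j : rat := 'C(2 * n - j, n)%:R - 'C(2 * n - j, n.+1)%:R.

Lemma natr_binS n m : 'C(n.+1, m.+1)%:R = 'C(n, m.+1)%:R + 'C(n, m)%:R :> rat.
Proof. by rewrite binS natrD. Qed.

Lemma ballotn0 n : ballot n 0 = catalan n.
Proof.
rewrite /ballot subn0 /catalan.
have := mul_bin_left (2 * n) n.
have -> : (2 * n - n = n)%N by lia.
move/(congr1 (fun k => k%:R : rat)); rewrite !natrM -natr1 => e.
have h1 : n%:R + 1 != 0 :> rat by rewrite natr1 pnatr_eq0.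
apply: (mulfI h1); rewrite mulrBr e natr1 div1r mulVKf ?pnatr_eq0 //; ring.
Qed.

(** The successor matters: by truncated subtraction [ballot 0 1] is 1. *)
Lemma ballotnS n : ballot n.+1 n.+2 = 0.
Proof. by rewrite /ballot !bin_small ?subr0 //; lia. Qed.

Lemma ballot_rec n j : (j <= n)%N ->
  ballot n.+1 j.+1 = ballot n.+1 j.+2 + ballot n j.
Proof.
move=> hj; rewrite /ballot.
have -> : (2 * n.+1 - j.+1 = (2 * n - j).+1)%N by lia.
have -> : (2 * n.+1 - j.+2 = 2 * n - j)%N by lia.
by rewrite !natr_binS; lra.
Qed.

(** A path that returns to the axis has a forced last down-step. In binomials, Pascal's rule and the
    symmetry of row 2n+1 give the same. *)
Lemma ballot_rec0 n : ballot n.+1 0 = ballot n.+1 1.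
Proof.
rewrite /ballot.
have -> : (2 * n.+1 - 0 = (2 * n).+2)%N by lia.
have -> : (2 * n.+1 - 1 = (2 * n).+1)%N by lia.
rewrite (natr_binS (2 * n).+1 n) (natr_binS (2 * n).+1 n.+1).
have -> : ('C((2 * n).+1, n) = 'C((2 * n).+1, n.+1))%N.
  by rewrite -bin_sub; [congr ('C(_, _)); lia|lia].
by lra.
Qed.

Lemma ballot_sumS n j : (j <= n)%N ->
  ballot n.+1 j.+1 = \sum_(j <= l < n.+1) ballot n l.
Proof.
(* Downward induction on j, starting from j = n. *)
move=> hj; have {hj} [d ->] : exists d, j = (n - d)%N by exists (n - j)%N; lia.
elim: d => [|d IH].
  by rewrite subn0 big_nat1 ballot_rec // ballotnS add0r.
(* For d >= n both truncated differences are 0, so the claim is the previous one. *)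
case: (ltnP d n) => hd; last by have -> : (n - d.+1 = n - d)%N by lia.
rewrite big_ltn; last lia.
rewrite ballot_rec; last lia.
have e : (n - d = (n - d.+1).+1)%N by lia.
by rewrite e in IH; rewrite addrC -IH.
Qed.

(** The predecessor merges the cases j = 0 and j = 1. This is the recursion that
    [size_tail_avoidersS] establishes for words. *)
Lemma ballot_sum n j : (j <= n.+1)%N ->
  ballot n.+1 j = \sum_(j.-1 <= l < n.+1) ballot n l.
Proof.
case: j => [|j] hj; last exact: ballot_sumS.
by rewrite ballot_rec0 ballot_sumS.
Qed.

(** * Fine numbers and their convolutions *)

Definition fine_term m k : rat :=
  'C(2 * m - 2 * k - 1, m - 1)%:R - 'C(2 * m - 2 * k - 1, m)%:R.

(** Once 2k > m + 1, the upper index 2m + 1 - 2k is below m and both binomials vanish. A range free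
    of halving lets sums for consecutive m be compared term by term. *)
Lemma fine_extend m : fine_number m.+1 = \sum_(1 <= k < m.+1) fine_term m.+1 k.
Proof.
rewrite /fine_number /= (@big_cat_nat _ _ _ (uphalf m).+1 1 m.+1) //=; last lia.
rewrite -[LHS]addr0; congr (_ + _); rewrite big_nat_cond big1 // => k hk.
rewrite /fine_term !bin_small ?subr0 //; lia.
Qed.

Lemma fine_number0 : fine_number 0 = 1. Proof. by []. Qed.

Lemma catalan_diff p :
  'C((2 * p).+1, p.+1)%:R - 'C((2 * p).+1, p.+2)%:R = catalan p.+1.
Proof.
rewrite -ballotn0 ballot_rec0 /ballot.
by have -> : (2 * p.+1 - 1 = (2 * p).+1)%N by lia.
Qed.

(** Pascal's rule applied twice: the three terms on the right share the upper index 2(m - k) + 1. *)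
Lemma fine_termS m k : (k <= m)%N ->
  fine_term m.+3 k.+1 =
    fine_term m.+3 k.+2 + 2%:R * fine_term m.+2 k.+1 + fine_term m.+1 k.
Proof.
move=> hk; rewrite /fine_term.
have -> : (2 * m.+3 - 2 * k.+1 - 1 = (2 * (m - k) + 1).+2)%N by lia.
have -> : (2 * m.+3 - 2 * k.+2 - 1 = (2 * (m - k) + 1))%N by lia.
have -> : (2 * m.+2 - 2 * k.+1 - 1 = (2 * (m - k) + 1))%N by lia.
have -> : (2 * m.+1 - 2 * k - 1 = (2 * (m - k) + 1))%N by lia.
rewrite !subn1 /= !natr_binS; ring.
Qed.

(** Summing [fine_termS] over k telescopes. The surviving first term is a Catalan number by
    [catalan_diff]; the last term vanishes, and so does [fine_term m.+1 0], by symmetry of the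
    binomials. *)
Lemma fine_catalan n : 2%:R * fine_number n.+1 + fine_number n = catalan n.+1.
Proof.
case: n => [|m].
  by rewrite fine_extend big_geq // -catalan_conv /conv big_ord_recl big_ord0 catalan0.
have e : \sum_(1 <= k < m.+2) fine_term m.+3 k =
    \sum_(1 <= k < m.+2) fine_term m.+3 k.+1
    + 2%:R * fine_number m.+2 + (fine_term m.+1 0 + fine_number m.+1).
  rewrite !fine_extend mulr_sumr -[X in _ + X](@big_ltn _ _ _ 0 m.+1 (fine_term m.+1)) //.
  rewrite !big_add1 /= -!big_split; apply: eq_big_nat => k hk.
  by rewrite fine_termS //; lia.
move: e; rewrite [X in X = _]big_ltn // [X in _ + X]big_add1 /=.
rewrite [X in _ = X + _ + _]big_nat_recr //=.
have -> : fine_term m.+1 0 = 0.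
  rewrite /fine_term; have -> : (2 * m.+1 - 2 * 0 - 1 = (2 * m).+1)%N by lia.
  rewrite subn1 /= -(@bin_sub (2 * m).+1 m); last lia.
  have -> : ((2 * m).+1 - m = m.+1)%N by lia.
  by rewrite subrr.
have -> : fine_term m.+3 m.+2 = 0.
  by rewrite /fine_term !bin_small ?subrr //; lia.
have <- : fine_term m.+3 1 = catalan m.+2.
  rewrite -catalan_diff /fine_term.
  by have -> : (2 * m.+3 - 2 * 1 - 1 = (2 * m.+1).+1)%N by lia.
rewrite !add0r addr0 => e; lra.
Qed.

(** The identity 2F + xF = C + 1 multiplied by the generating function of g. *)
Lemma conv_fine g n :
  2%:R * conv fine_number g n.+1 + conv fine_number g n =
  conv catalan g n.+1 + g n.+1.
Proof.
rewrite /conv big_ord_recl [in RHS]big_ord_recl catalan0 /= subn0.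
rewrite mulrDr mulr_sumr -addrA -big_split /= !mul1r.
under eq_bigr => i _ do rewrite subSS mulrA -mulrDl fine_catalan.
under [in RHS]eq_bigr => i _ do rewrite subSS.
by ring.
Qed.

(* Both sides satisfy 2 x_n + x_(n-1) = catalan n.+1 + catalan n. *)
Lemma conv_fine_catalan n :
  conv fine_number catalan n = catalan n.+1 - fine_number n.+1.
Proof.
elim: n => [|n IH].
  rewrite /conv big_ord_recl big_ord0 subnn catalan0.
  by have := fine_catalan 0; rewrite fine_extend big_geq //= !fine_number0; lra.
have := conv_fine catalan n; rewrite IH catalan_conv.
have := fine_catalan n.+1; lra.
Qed.

(** The equation C = D + x D C determines D degree by degree, since the convolution at n involves d
    only up to n; by [conv_fine_catalan] the Fine numbers solve it. *)
Lemma derangements_fine (d c : nat -> rat) :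
  c =1 catalan -> d 0%N = 1 -> (forall n, c n.+1 = d n.+1 + conv d c n) ->
  d =1 fine_number.
Proof.
move=> c_cat d0 d_rec n; have [m] := ubnP n; elim: m n => // m IH [|n] hn; first by rewrite d0.
have := d_rec n; have -> : conv d c n = conv fine_number catalan n.
  by apply: eq_bigr => i _; rewrite c_cat IH //; have := ltn_ord i; lia.
rewrite conv_fine_catalan c_cat; lra.
Qed.

Lemma conv_fine_fine n :
  2%:R * conv fine_number fine_number n.+1 + conv fine_number fine_number n =
  catalan n.+2 - fine_number n.+2 + fine_number n.+1.
Proof. by rewrite conv_fine convC conv_fine_catalan. Qed.

(** Eliminating F_(n+2) from [conv_fine_fine] by [fine_catalan] gives x_(n+1) = - x_n / 2 + (C_(n+2)
    + 3 F_(n+1)) / 4. Splitting off the term i = 0 shows that the sum obeys the same recurrence. *)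
Lemma conv_fine_formula n :
  conv fine_number fine_number n = 1 / 4%:R * \sum_(0 <= i < n.+1)
    (- 1 / 2%:R) ^+ i * (catalan (n.+1 - i) + 3%:R * fine_number (n.+1 - i - 1)).
Proof.
elim: n => [|n IH].
  rewrite big_nat1 /conv big_ord_recl big_ord0 expr0.
  change (fine_number 0 * fine_number 0 + 0 =
    1 / 4%:R * (1 * (catalan 1 + 3%:R * fine_number 0))).
  have := fine_catalan 0; rewrite fine_extend big_geq //= !fine_number0; lra.
rewrite div1r in IH *; rewrite big_nat_recl // expr0 mul1r subn0 subn1.
under eq_bigr => i _ do rewrite exprS subSS -mulrA.
rewrite -mulr_sumr mulrDr mulrCA -IH.
have := conv_fine_fine n; have := fine_catalan n.+1; lra.
Qed.

End Numbers.

(** * Words and block insertion *)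

Lemma pigeonhole (f : nat -> nat) a m b k :
  (forall i, a <= i < a + m -> b <= f i < b + k) ->
  (forall i j, a <= i < a + m -> a <= j < a + m -> f i = f j -> i = j) ->
  m <= k.
Proof.
move=> hf hinj; rewrite -(size_iota a m) -(size_iota b k) -(size_map f).
apply: uniq_leq_size => [|_ /mapP[i hi ->]]; last first.
  by move: hi; rewrite !mem_iota; apply: hf.
rewrite map_inj_in_uniq ?iota_uniq // => i j.
by rewrite !mem_iota; apply: hinj.
Qed.

Definition words n : seq (seq nat) := permutations (iota 0 n).

(** A pointwise description of the permutations of 0, ..., n-1, suited to linear arithmetic;
    surjectivity is recovered in [word_surj]. *)
Definition is_word n s : Prop :=
  [/\ size s = n,
      forall p, p < n -> nth 0 s p < n
    & forall p q, p < n -> q < n -> nth 0 s p = nth 0 s q -> p = q].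

Lemma wordP n s : reflect (is_word n s) (s \in words n).
Proof.
rewrite mem_permutations; apply: (iffP idP) => [hp|[hs hlt hinj]].
  have hsz : size s = n by rewrite (perm_size hp) size_iota.
  have hu : uniq s by rewrite (perm_uniq hp) iota_uniq.
  split=> // [p hp'|p q hp' hq].
    have : nth 0 s p \in s by rewrite mem_nth // hsz.
    by rewrite (perm_mem hp) mem_iota add0n.
  by move=> /eqP; rewrite nth_uniq ?hsz // => /eqP.
have hu : uniq s.
  by apply/(uniqP 0) => p q; rewrite !inE hs; apply: hinj.
apply: uniq_perm => //; first exact: iota_uniq.
have hsub : {subset s <= iota 0 n}.
  move=> v /(nthP 0)[p]; rewrite hs => hp <-.
  by rewrite mem_iota add0n hlt.
by case: (uniq_min_size hu hsub); rewrite ?size_iota ?hs.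
Qed.

Lemma word_surj n s v : is_word n s -> v < n -> exists2 p, p < n & nth 0 s p = v.
Proof.
move=> hw hv; have /wordP := hw; rewrite mem_permutations => hp.
have : v \in s by rewrite (perm_mem hp) mem_iota add0n.
by case: hw => hs _ _ /(nthP 0)[p]; rewrite hs => ? ?; exists p.
Qed.

(** A further position q with value in the box would send m+2 positions injectively to m+1 values.
    In [f] the index a+m+1 stands for q. *)
Lemma word_box n s a b m : is_word n s -> a + m < n ->
  (forall p, a <= p <= a + m -> b <= nth 0 s p <= b + m) ->
  forall q, q < n -> ~~ (a <= q <= a + m) -> ~~ (b <= nth 0 s q <= b + m).
Proof.
move=> [_ _ hinj] ham hbox q hq hqa; apply/negP => hqb.
pose f i := if i == (a + m).+1 then nth 0 s q else nth 0 s i.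
suff : m.+2 <= m.+1 by lia.
apply: (@pigeonhole f a m.+2 b m.+1) => [i|i j]; rewrite /f.
  by move=> hi; case: eqP => hi'; [lia | have := hbox i; lia].
move=> hi hj; case: eqP => hi'; case: eqP => hj'; first by lia.
- move=> e; have := hinj q j; lia.
- move=> e; have := hinj i q; lia.
- by move=> e; apply: hinj => //; lia.
Qed.

(** The increasing bijection from the naturals onto the complement of b, ..., b+m, the values
    reserved for an inserted block. *)
Definition skip b m v := if v < b then v else (v + m).+1.

(* Inserts into the permutation matrix of t, at the corner (a, b), the square
   block with matrix s (+) 1. *)
Definition insert a b (s t : seq nat) : seq nat :=
  mkseq (fun p => if p < a then skip b (size s) (nth 0 t p)
                  else if p < a + size s then b + nth 0 s (p - a)
                  else if p == a + size s then b + size s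
                  else skip b (size s) (nth 0 t (p - (size s).+1)))
        (size s + size t).+1.

Lemma size_insert a b s t : size (insert a b s t) = (size s + size t).+1.
Proof. by rewrite size_mkseq. Qed.

Lemma nth_insert a b s t p : p < (size s + size t).+1 ->
  let v := nth 0 (insert a b s t) p in
  [\/ p < a /\ v = skip b (size s) (nth 0 t p),
      a <= p < a + size s /\ v = b + nth 0 s (p - a),
      p = a + size s /\ v = b + size s
    | a + size s < p /\ v = skip b (size s) (nth 0 t (p - (size s).+1))].
Proof.
move=> hp /=; rewrite nth_mkseq //.
case: ltnP => h1; first by constructor 1.
case: ltnP => h2; first by constructor 2.
by case: eqP => h3; [constructor 3 | constructor 4; split=> //; lia].
Qed.

Lemma nth_insert_left a b s t p : p < a -> p < size t ->
  nth 0 (insert a b s t) p = skip b (size s) (nth 0 t p).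
Proof. by move=> h1 h2; rewrite nth_mkseq ?h1 //; lia. Qed.

Lemma nth_insert_right a b s t p : a <= p -> p < size t ->
  nth 0 (insert a b s t) (p + (size s).+1) = skip b (size s) (nth 0 t p).
Proof.
move=> h1 h2; rewrite nth_mkseq; last lia.
rewrite ifN; last lia.
by rewrite ifN ?ifN ?addnK //; lia.
Qed.

Lemma nth_insert_box a b s t p : p < size s -> a <= size t ->
  nth 0 (insert a b s t) (a + p) = b + nth 0 s p.
Proof.
move=> h1 h2; rewrite nth_mkseq; last lia.
by rewrite ifN ?ifT; [congr (b + nth _ _ _) | |]; lia.
Qed.

Lemma nth_insert_last a b s t : a <= size t ->
  nth 0 (insert a b s t) (a + size s) = b + size s.
Proof.
move=> h; rewrite nth_mkseq; last lia.
by rewrite ifN ?ltnn ?eqxx //; lia.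
Qed.

Lemma skip_mono b m : {mono skip b m : x y / x < y}.
Proof. by move=> x y; rewrite /skip; do 2?case: ifP; lia. Qed.

Lemma skip_inj b m : injective (skip b m).
Proof. by move=> x y; rewrite /skip; do 2?case: ifP; lia. Qed.

Lemma skip_bound b m n v : b <= n -> v < n -> skip b m v < (m + n).+1.
Proof. by rewrite /skip; case: ifP; lia. Qed.

Lemma skip_outside b m v : ~~ (b <= skip b m v <= b + m).
Proof. by rewrite /skip; case: ifP; lia. Qed.

Lemma insert_word a b m n s t : is_word m s -> is_word n t -> a <= n -> b <= n ->
  is_word (m + n).+1 (insert a b s t).
Proof.
move=> [hs slt sinj] [ht tlt tinj] han hbn.
have sz : size (insert a b s t) = (m + n).+1 by rewrite size_insert hs ht.
split=> // [p|p q].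
  move=> hp; have := @nth_insert a b s t p; rewrite hs ht => /(_ hp) /= [] [h ->].
  - by apply: skip_bound => //; apply: tlt; lia.
  - have := slt (p - a); lia.
  - lia.
  - by apply: skip_bound => //; apply: tlt; lia.
move=> hp hq.
have := @nth_insert a b s t p; rewrite hs ht => /(_ hp) /=.
have := @nth_insert a b s t q; rewrite hs ht => /(_ hq) /=.
(* Entries coming from t miss the values of the block, so equal entries come both from t or both
   from the block. *)
have sb x := skip_outside b m (nth 0 t x).
case=> [] [h ->] [] [h' ->]; (try lia).
- by move/skip_inj => e; apply: tinj => //; lia.
- have := slt (p - a); have := sb q; lia.
- have := sb q; lia.
- move/skip_inj/tinj; lia.
- have := slt (q - a); have := sb p; lia.
- move/addnI/sinj; lia.
- have := slt (q - a); lia.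
- have := slt (q - a); have := sb (p - m.+1); lia.
- have := sb p; lia.
- have := slt (p - a); lia.
- have := sb (p - m.+1); lia.
- move/skip_inj/tinj; lia.
- have := slt (p - a); have := sb (q - m.+1); lia.
- have := sb (q - m.+1); lia.
- move/skip_inj/tinj; lia.
Qed.

Lemma insert_inj a b s t s' t' : size s = size s' -> size t = size t' ->
  a <= size t -> insert a b s t = insert a b s' t' -> s = s' /\ t = t'.
Proof.
move=> hs ht ha e; split; apply: (@eq_from_nth _ 0) => // p hp.
  have := congr1 (nth 0 ^~ (a + p)) e.
  by rewrite /= !nth_insert_box -?ht -?hs // => /addnI.
case: (ltnP p a) => hpa.
  have := congr1 (nth 0 ^~ p) e.
  by rewrite /= !nth_insert_left -?ht -?hs // => /skip_inj.
have := congr1 (nth 0 ^~ (p + (size s).+1)) e.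
by rewrite /= {2}hs !nth_insert_right -?ht -?hs // => /skip_inj.
Qed.

(** Converse of [insert_word]: by [word_box] the entries outside the box miss its m+1 values, so the
    gap in positions and in values can be closed. *)
Lemma insert_decomp n s a b m : is_word n s -> a + m < n ->
  (forall p, a <= p < a + m -> b <= nth 0 s p < b + m) ->
  nth 0 s (a + m) = b + m ->
  exists s1 s2, [/\ is_word m s1, is_word (n.-1 - m) s2 & s = insert a b s1 s2].
Proof.
move=> hw ham hbox hlast.
have hout : forall q, q < n -> ~~ (a <= q <= a + m) -> ~~ (b <= nth 0 s q <= b + m).
  apply: word_box => // p hp; have := hbox p.
  by have [->|] := eqVneq p (a + m); [rewrite hlast | ]; lia.
have [hs slt sinj] := hw.
(* [unskip] inverts [skip b m] off the gap; [lift] is the position in s of an entry of the remaining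
   word. *)
pose unskip v := if v < b then v else v - m.+1.
pose lift p := if p < a then p else p + m.+1.
have skipK v : ~~ (b <= v <= b + m) -> skip b m (unskip v) = v.
  by rewrite /skip /unskip; case: (ltnP v b) => h h'; case: ifP; lia.
have hbm : b + m < n by rewrite -hlast slt.
have lift_lt p : p < n.-1 - m -> lift p < n by rewrite /lift; case: ifP; lia.
have lift_out p : p < n.-1 - m -> ~~ (b <= nth 0 s (lift p) <= b + m).
  by move=> hp; apply: hout; rewrite ?lift_lt // /lift; case: ifP; lia.
pose s1 := mkseq (fun p => nth 0 s (a + p) - b) m.
pose s2 := mkseq (fun p => unskip (nth 0 s (lift p))) (n.-1 - m).
exists s1, s2.
have w1 : is_word m s1.
  split=> [|p hp|p q hp hq]; first by rewrite size_mkseq.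
    by rewrite nth_mkseq //; have := hbox (a + p); lia.
  rewrite !nth_mkseq // => e.
  have := hbox (a + p); have := hbox (a + q); have := sinj (a + p) (a + q); lia.
have w2 : is_word (n.-1 - m) s2.
  split=> [|p hp|p q hp hq]; first by rewrite size_mkseq.
    rewrite nth_mkseq //; have := lift_out p hp; have := slt _ (lift_lt p hp).
    by rewrite /unskip; case: ifP; lia.
  rewrite !nth_mkseq // => e.
  have : nth 0 s (lift p) = nth 0 s (lift q).
    by rewrite -[LHS]skipK ?lift_out // e skipK ?lift_out.
  move/sinj => /(_ (lift_lt p hp) (lift_lt q hq)).
  by rewrite /lift; do 2?case: ifP; lia.
split=> //; have [z1 _ _] := w1; have [z2 _ _] := w2.
have sz : (m + (n.-1 - m)).+1 = n by lia.
apply: (@eq_from_nth _ 0) => [|p]; first by rewrite size_insert z1 z2 sz.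
rewrite hs => hp; have := @nth_insert a b s1 s2 p.
rewrite z1 z2 sz => /(_ hp) /= [] [h ->].
- rewrite nth_mkseq; last lia.
  have e : lift p = p by rewrite /lift; case: ifP; lia.
  by rewrite skipK e // hout //; lia.
- rewrite nth_mkseq; last lia.
  have -> : a + (p - a) = p by lia.
  by have := hbox p; lia.
- by rewrite h hlast.
- rewrite nth_mkseq; last lia.
  have e : lift (p - m.+1) = p by rewrite /lift; case: ifP; lia.
  by rewrite skipK e // hout //; lia.
Qed.

(** * Pattern avoidance of words *)

Section Avoidance.
Variable R : nat -> nat -> nat -> bool.

Definition avoids s :=
  all (fun k => all (fun j => all (fun i =>
    ~~ R (nth 0 s i) (nth 0 s j) (nth 0 s k)) (iota 0 j)) (iota 0 k))
  (iota 0 (size s)).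

Lemma avoidsP s :
  reflect (forall i j k, i < j -> j < k -> k < size s ->
             ~~ R (nth 0 s i) (nth 0 s j) (nth 0 s k))
          (avoids s).
Proof.
apply: (iffP idP) => [/allP h i j k hij hjk hk|h].
  have /allP/(_ j) := h k ltac:(by rewrite mem_iota).
  by rewrite mem_iota hjk => /(_ isT)/allP/(_ i); rewrite mem_iota hij => ->.
apply/allP => k; rewrite mem_iota => hk.
apply/allP => j; rewrite mem_iota => hj.
by apply/allP => i; rewrite mem_iota => hi; apply: h.
Qed.

Definition order_pattern :=
  forall f, {mono f : x y / x < y} -> forall x y z, R (f x) (f y) (f z) = R x y z.

(** Both words survive as patterns: s through translation by b, t through the increasing map
    [skip]. *)
Lemma insert_avoids a b s t : order_pattern -> a <= size t ->
  avoids (insert a b s t) -> avoids s /\ avoids t.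
Proof.
move=> hR ha /avoidsP h; split; apply/avoidsP => i j k hij hjk hk.
  have := h (a + i) (a + j) (a + k); rewrite size_insert !nth_insert_box; try lia.
  rewrite (hR (addn b)); last by move=> x y; rewrite ltn_add2l.
  by apply; lia.
pose lift p := if p < a then p else p + (size s).+1.
have e p : p < size t -> nth 0 (insert a b s t) (lift p) = skip b (size s) (nth 0 t p).
  rewrite /lift; case: ifP => hpa hp; first exact: nth_insert_left.
  by apply: nth_insert_right => //; lia.
have := h (lift i) (lift j) (lift k).
rewrite !e; try lia.
rewrite hR; last exact: skip_mono.
by apply; rewrite ?size_insert /lift; do 3?case: ifP; lia.
Qed.

Definition avoiders n := [seq s <- words n | avoids s].

Lemma avoidersP n s : reflect (is_word n s /\ avoids s) (s \in avoiders n).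
Proof. by rewrite mem_filter; apply: (iffP andP) => [[? /wordP]|[/wordP]]. Qed.

Lemma avoiders_uniq n : uniq (avoiders n).
Proof. by rewrite filter_uniq // permutations_uniq. Qed.

End Avoidance.

(** The common frame of the four counting recursions: i is the length of the inserted block or of an
    increasing tail, x the remaining data, and f the gluing map. *)
Lemma size_dep_bij (I U T : eqType) (r : seq I) (Z : I -> seq U)
    (f : I -> U -> T) (s : seq T) :
  uniq s -> uniq r -> {in r, forall i, uniq (Z i)} ->
  {in r, forall i, {in Z i, forall x, f i x \in s}} ->
  {in r &, forall i j, {in Z i & Z j, forall x y, f i x = f j y -> i = j /\ x = y}} ->
  {in s, forall y, exists i x, [/\ i \in r, x \in Z i & y = f i x]} ->
  size s = \sum_(i <- r) size (Z i).
Proof.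
move=> us ur uZ hf hinj hsurj.
have -> : \sum_(i <- r) size (Z i) = size [seq f i x | i <- r, x <- Z i].
  by rewrite size_allpairs_dep sumnE big_map.
apply/perm_size/uniq_perm => //.
  apply: allpairs_uniq_dep => // -[i x] [j y] /allpairsPdep[i' [x' [hi hx e]]].
  move=> /allpairsPdep[j' [y' [hj hy e']]] /=; case: e e' => -> -> [-> ->].
  by case/hinj => // -> ->.
move=> y; apply/idP/allpairsPdep => [/hsurj|[i [x [hi hx ->]]]]; last exact: hf.
by move=> [i [x [? ? ?]]]; exists i, x.
Qed.

(** * Marked fixed points *)

Definition derangement (s : seq nat) :=
  all (fun p => nth 0 s p != p) (iota 0 (size s)).

Definition one_fixed_point (s : seq nat) :=
  count (fun p => nth 0 s p == p) (iota 0 (size s)) == 1.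

Lemma derangementP s :
  reflect (forall p, p < size s -> nth 0 s p <> p) (derangement s).
Proof.
apply: (iffP allP) => h p; first by move=> hp; apply/eqP/h; rewrite mem_iota.
by rewrite mem_iota => hp; apply/eqP/h.
Qed.

Lemma one_fixed_pointP s :
  reflect (exists2 p, p < size s /\ nth 0 s p = p &
             forall q, q < size s -> nth 0 s q = q -> q = p)
          (one_fixed_point s).
Proof.
rewrite /one_fixed_point; set P : pred nat := fun p => nth 0 s p == p.
have hP p : (p \in filter P (iota 0 (size s))) = (nth 0 s p == p) && (p < size s).
  by rewrite mem_filter mem_iota.
rewrite -size_filter; apply: (iffP eqP) => [e|[p [hp1 hp2] hq]].
  case: (filter _ _) e hP => [|p [|]] // _ hP.
  have := hP p; rewrite mem_head => /esym/andP[/eqP h1 h2].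
  exists p => // q h3 h4; apply/eqP.
  by have := hP q; rewrite inE h3 h4 eqxx => ->.
have : perm_eq (filter P (iota 0 (size s))) [:: p].
  apply: uniq_perm; rewrite ?filter_uniq ?iota_uniq // => q.
  rewrite hP inE; apply/andP/eqP => [[/eqP ? ?]|->]; first exact: hq.
  by rewrite hp2.
by move/perm_size.
Qed.

(** The first a entries of t lie above the diagonal and are only raised. Of the entries behind the
    block, those with value at least a move along the diagonal, and the others stay below it. *)
Lemma insert_fixed_point a s t p : a <= size t ->
  (forall q, q < a -> a <= nth 0 t q) ->
  p < (size s + size t).+1 ->
  (nth 0 (insert a a s t) p = p <->
   [\/ a <= p < a + size s /\ nth 0 s (p - a) = p - a,
       p = a + size s
     | a + size s < p /\ nth 0 t (p - (size s).+1) = p - (size s).+1]).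
Proof.
move=> ha hta hp; have := @nth_insert a a s t p hp => /= -[] [h ->].
- split; last by case; lia.
  by have := hta p; rewrite /skip; case: ifP; lia.
- split; last by case; lia.
  by move=> e; constructor 1; lia.
- by split=> // _; constructor 2.
- split; last first.
    by case; try lia; case=> _ ->; rewrite /skip; case: ifP; lia.
  by rewrite /skip; case: ifP => h' e; constructor 3; lia.
Qed.

Section FixedPointInsertion.
Variables (R : nat -> nat -> nat -> bool) (corner : seq nat -> nat).

(* Inserting s (+) 1 into t at the diagonal point (corner t, corner t) is a
   bijection from pairs of avoiders to avoiders with a marked fixed point, the
   mark being the last entry of the inserted block. *)
Definition fixed_point_insertion : Prop :=
  [/\ order_pattern R,
      forall t, corner t <= size t,
      forall n t p, is_word n t -> p < corner t -> corner t <= nth 0 t p,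
      forall m n s t, is_word m s -> is_word n t -> avoids R s -> avoids R t ->
        avoids R (insert (corner t) (corner t) s t)
    & forall n s i, is_word n s -> avoids R s -> i < n -> nth 0 s i = i ->
        exists a, [/\ a <= i, forall p, p < a -> i < nth 0 s p,
          forall p, a <= p < i -> a <= nth 0 s p < i
        & forall k u v, is_word (i - a) u -> is_word k v ->
            s = insert a a u v -> corner v = a]].

Hypothesis HR : fixed_point_insertion.

Let ins s t := insert (corner t) (corner t) s t.

Definition avoiding_derangements n := [seq s <- avoiders R n | derangement s].

Definition one_fixed_avoiders n := [seq s <- avoiders R n | one_fixed_point s].

Lemma avoiding_derangementsP n s :
  reflect [/\ is_word n s, avoids R s & derangement s]
          (s \in avoiding_derangements n).
Proof.
rewrite mem_filter; apply: (iffP andP) => [[h /avoidersP[]]|[h1 h2 h3]] //.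
by split=> //; apply/avoidersP.
Qed.

Lemma ins_avoiders m n s t : s \in avoiders R m -> t \in avoiders R n ->
  ins s t \in avoiders R (m + n).+1.
Proof.
case: HR => _ cle _ hav _ /avoidersP[ws avs] /avoidersP[wt avt].
apply/avoidersP; split; last exact: hav ws wt avs avt.
by have := cle t; case: (wt) => -> _ _ ?; apply: insert_word.
Qed.

(** Suppose [corner t < corner t']. Position [corner t] opens the block of the first word, with an
    entry below the common mark, but precedes the block of the second, where its entry exceeds the
    mark. So the corners agree, and [insert_inj] applies. *)
Lemma ins_marked_inj m n m' n' s t s' t' :
  is_word m s -> is_word n t -> is_word m' s' -> is_word n' t' ->
  m + n = m' + n' -> corner t + m = corner t' + m' -> ins s t = ins s' t' ->
  [/\ m = m', s = s' & t = t'].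
Proof.
case: HR => _ cle cge _ _.
wlog hw : m n m' n' s t s' t' / corner t <= corner t' => [h|].
  move=> ws wt ws' wt' e1 e2 e3.
  have [hc|hc] := leqP (corner t) (corner t'); first exact: (h m n m' n').
  by have [] := h m' n' m n s' t' s t (ltnW hc) ws' wt' ws wt (esym e1) (esym e2) (esym e3).
move=> ws wt ws' wt' e1 e2 e3.
have [zs slt _] := ws; have [zt tlt _] := wt.
have [zs' slt' _] := ws'; have [zt' tlt' _] := wt'.
have ct := cle t; have ct' := cle t'.
have ec : corner t = corner t'.
  apply/eqP; rewrite eqn_leq hw leqNgt; apply/negP => hlt.
  have := congr1 (nth 0 ^~ (corner t)) e3; rewrite /= /ins.
  rewrite [RHS]nth_insert_left //; last lia.
  rewrite -[X in nth 0 _ X]addn0 nth_insert_box; try lia.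
  have := cge _ _ (corner t) wt' hlt; have := slt 0.
  by rewrite /skip; case: ifP; lia.
have em : m = m' by lia.
have en : n = n' by lia.
move: e3; rewrite /ins -ec => /insert_inj[]; rewrite ?zs ?zs' ?zt ?zt' //.
by rewrite -zt.
Qed.

Lemma marked_decomp n s i : s \in avoiders R n.+1 -> i < n.+1 -> nth 0 s i = i ->
  exists m u v, [/\ m <= n, u \in avoiders R m, v \in avoiders R (n - m),
                    s = ins u v & i = corner v + m].
Proof.
case: HR => hp cle _ _ hdec /avoidersP[ws avs] hi e.
have [a [hai hpa hbox hc]] := hdec _ _ _ ws avs hi e.
have [||| u [v [wu wv es]]] := @insert_decomp n.+1 s a a (i - a) ws.
- lia.
- by move=> p; have := hbox p; lia.
- by rewrite subnKC.
rewrite /= in wv.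
have ec := hc _ _ _ wu wv es.
have [zu _ _] := wu; have [zv _ _] := wv.
have hav : a <= size v by rewrite -ec.
rewrite es in avs; have [au av] := insert_avoids hp hav avs.
exists (i - a), u, v; split; try lia.
- exact/avoidersP.
- exact/avoidersP.
- by rewrite /ins ec.
Qed.

Lemma ins_fixed_point m n s t p : is_word m s -> is_word n t -> p < (m + n).+1 ->
  (nth 0 (ins s t) p = p <->
   [\/ corner t <= p < corner t + m /\ nth 0 s (p - corner t) = p - corner t,
       p = corner t + m
     | corner t + m < p /\ nth 0 t (p - m.+1) = p - m.+1]).
Proof.
case: HR => _ cle cge _ _ ws wt; have [<- _ _] := ws; have [<- _ _] := wt => hp.
apply: insert_fixed_point => // q; exact: cge wt.
Qed.

Lemma size_pairs (U V : eqType) (x : seq U) (y : seq V) :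
  size [seq (i, j) | i <- x, j <- y] = size x * size y.
Proof. by rewrite size_allpairs. Qed.

(* Decompose at the unique fixed point. *)
Lemma size_one_fixed_avoiders n :
  size (one_fixed_avoiders n.+1) =
  \sum_(0 <= m < n.+1)
    size (avoiding_derangements m) * size (avoiding_derangements (n - m)).
Proof.
case: (HR) => _ cle cge _ _.
under eq_bigr => m _ do rewrite -size_pairs.
apply: (size_dep_bij (f := fun _ x => ins x.1 x.2)).
- exact/filter_uniq/avoiders_uniq.
- exact: iota_uniq.
- move=> m _; apply: allpairs_uniq; [exact/filter_uniq/avoiders_uniq.. | ].
  by move=> [? ?] [? ?] _ _ [-> ->].
- move=> m; rewrite mem_index_iota => hm _ /allpairsP[[s t] /= [hs ht ->]] /=.
  move: hs ht; rewrite [s \in _]mem_filter [t \in _]mem_filter [ins s t \in _]mem_filter.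
  move=> /andP[/derangementP ds hs] /andP[/derangementP dt ht].
  have := ins_avoiders hs ht; have -> : m + (n - m) = n by lia.
  move=> h; rewrite h andbT; have [[zi _ _] _] := avoidersP _ _ _ h.
  have [ws _] := avoidersP _ _ _ hs; have [wt _] := avoidersP _ _ _ ht.
  have [zs _ _] := ws; have [zt _ _] := wt; have ct := cle t.
  apply/one_fixed_pointP; exists (corner t + m); rewrite zi.
    by split; [lia | apply/(ins_fixed_point ws wt); [lia | constructor 2]].
  move=> q hq /(ins_fixed_point ws wt) []; first lia; last 2 first; first done.
  + by case=> h1 h2; have := dt (q - m.+1); lia.
  + by case=> h1 h2; have := ds (q - corner t); lia.
- move=> i j; rewrite !mem_index_iota => hi hj x y /allpairsP[[s t] /= [hs ht ->]].
  move=> /allpairsP[[s' t'] /= [hs' ht' ->]] /= e.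
  move: hs ht hs' ht' => /avoiding_derangementsP[ws _ /derangementP ds].
  move=> /avoiding_derangementsP[wt _ /derangementP dt].
  move=> /avoiding_derangementsP[ws' _ _] /avoiding_derangementsP[wt' _ _].
  have eN : i + (n - i) = j + (n - j) by lia.
  (* The mark of the second decomposition is a fixed point of the first, whose two parts are
     derangements, so it can only be the first mark. *)
  suff eC : corner t + i = corner t' + j.
    by have [-> -> ->] := ins_marked_inj ws wt ws' wt' eN eC e.
  have [zs _ _] := ws; have [zt _ _] := wt; have [zt' _ _] := wt'.
  have ct := cle t; have ct' := cle t'.
  have : nth 0 (ins s t) (corner t' + j) = corner t' + j.
    by rewrite e; apply/(ins_fixed_point ws' wt'); [lia | constructor 2].
  case/(ins_fixed_point ws wt); first lia; last 2 first; first lia.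
  + by case=> h1 h2; have := dt (corner t' + j - i.+1); lia.
  + by case=> h1 h2; have := ds (corner t' + j - corner t); lia.
- move=> s; rewrite mem_filter => /andP[/one_fixed_pointP[i [hi ei] hu] hs].
  have [[zs _ _] _] := avoidersP _ _ _ hs; rewrite zs in hi hu.
  have [m [u [v [hm hu' hv es ei']]]] := marked_decomp hs hi ei.
  have [wu _] := avoidersP _ _ _ hu'; have [wv _] := avoidersP _ _ _ hv.
  have [zu _ _] := wu; have [zv _ _] := wv; have cv := cle v.
  exists m, (u, v); split; [by rewrite mem_index_iota; lia | | done].
  apply/allpairsP; exists (u, v); split => //=; rewrite mem_filter ?hu' ?hv andbT.
  + apply/derangementP => p hp e; have := hu (corner v + p).
    have -> : nth 0 s (corner v + p) = corner v + p; last lia.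
    rewrite es; apply/(ins_fixed_point wu wv); first lia.
    by constructor 1; rewrite addKn; split => //; lia.
  + apply/derangementP => p hp e; have := hu (p + m.+1).
    (* Before the corner the entries of v are at least [corner v], hence not fixed. *)
    case: (ltnP p (corner v)) => hpc.
      by have [_ _ cge' _ _] := HR; have := cge' _ _ p wv hpc; lia.
    have -> : nth 0 s (p + m.+1) = p + m.+1; last lia.
    rewrite es; apply/(ins_fixed_point wu wv); first lia.
    by constructor 3; rewrite addnK; split => //; lia.
Qed.

(* Decompose at the smallest fixed point. *)
Lemma size_avoiders_rec n :
  size (avoiders R n.+1) = size (avoiding_derangements n.+1) +
  \sum_(0 <= m < n.+1)
    size (avoiding_derangements m) * size (avoiders R (n - m)).
Proof.
case: (HR) => _ cle cge _ _.
rewrite -(count_predC derangement) -size_filter; congr (_ + _).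
rewrite -size_filter.
under eq_bigr => m _ do rewrite -size_pairs.
apply: (size_dep_bij (f := fun _ x => ins x.1 x.2)).
- exact/filter_uniq/avoiders_uniq.
- exact: iota_uniq.
- move=> m _; apply: allpairs_uniq; [exact/filter_uniq/avoiders_uniq | exact: avoiders_uniq | ].
  by move=> [? ?] [? ?] _ _ [-> ->].
- move=> m; rewrite mem_index_iota => hm _ /allpairsP[[s t] /= [hs ht ->]] /=.
  move: hs; rewrite [s \in _]mem_filter [ins s t \in _]mem_filter => /andP[_ hs].
  have := ins_avoiders hs ht; have -> : m + (n - m) = n by lia.
  move=> h; rewrite h andbT; have [[zi _ _] _] := avoidersP _ _ _ h.
  have [ws _] := avoidersP _ _ _ hs; have [wt _] := avoidersP _ _ _ ht.
  have [zs _ _] := ws; have [zt _ _] := wt; have ct := cle t.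
  apply/derangementP => /(_ (corner t + m)); apply; first by rewrite zi; lia.
  by apply/(ins_fixed_point ws wt); [lia | constructor 2].
(* As s has no fixed point, the first mark is the smallest fixed point and is at most the second
   mark. Using this in both directions identifies the marks. *)
- have key i j s t s' t' : i < n.+1 -> j < n.+1 -> is_word i s ->
      is_word (n - i) t -> derangement s -> is_word j s' -> is_word (n - j) t' ->
      ins s t = ins s' t' -> corner t + i <= corner t' + j.
    move=> hi hj ws wt /derangementP ds ws' wt' e.
    have [zs _ _] := ws; have [zt _ _] := wt; have [zt' _ _] := wt'.
    have ct := cle t; have ct' := cle t'.
    have : nth 0 (ins s t) (corner t' + j) = corner t' + j.
      by rewrite e; apply/(ins_fixed_point ws' wt'); [lia | constructor 2].
    case/(ins_fixed_point ws wt); first lia; last 2 first; try lia.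
    by case=> h1 h2; have := ds (corner t' + j - corner t); lia.
  move=> i j; rewrite !mem_index_iota => hi hj x y /allpairsP[[s t] /= [hs ht ->]].
  move=> /allpairsP[[s' t'] /= [hs' ht' ->]] /= e.
  move: hs ht hs' ht' => /avoiding_derangementsP[ws _ ds] /avoidersP[wt _].
  move=> /avoiding_derangementsP[ws' _ ds'] /avoidersP[wt' _].
  have k1 := key _ _ _ _ _ _ hi hj ws wt ds ws' wt' e.
  have k2 := key _ _ _ _ _ _ hj hi ws' wt' ds' ws wt (esym e).
  have eN : i + (n - i) = j + (n - j) by lia.
  have eC : corner t + i = corner t' + j by lia.
  by have [-> -> ->] := ins_marked_inj ws wt ws' wt' eN eC e.
- move=> s; rewrite mem_filter => /andP[hd hs].
  have /allPn[i0 hi0 ei0] : ~~ derangement s := hd.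
  have [[zs _ _] _] := avoidersP _ _ _ hs; rewrite zs mem_iota in hi0.
  have ex : exists i, (i < n.+1) && (nth 0 s i == i) by exists i0; lia.
  case: (ex_minnP ex) => i /andP[hi /eqP ei] hmin.
  have [m [u [v [hm hu' hv es ei']]]] := marked_decomp hs hi ei.
  have [wu _] := avoidersP _ _ _ hu'; have [wv _] := avoidersP _ _ _ hv.
  have [zu _ _] := wu; have [zv _ _] := wv; have cv := cle v.
  exists m, (u, v); split; [by rewrite mem_index_iota; lia | | done].
  apply/allpairsP; exists (u, v); split => //=; rewrite mem_filter ?hu' andbT.
  apply/derangementP => p hp e; have := hmin (corner v + p).
  have -> : nth 0 s (corner v + p) = corner v + p; last by rewrite eqxx; lia.
  rewrite es; apply/(ins_fixed_point wu wv); first lia.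
  by constructor 1; rewrite addKn; split => //; lia.
Qed.

End FixedPointInsertion.

(** * The pattern 132 and the marked decompositions *)

Definition pat132 (x y z : nat) := (x < z) && (z < y).
Definition pat321 (x y z : nat) := (z < y) && (y < x).

Lemma order_pattern132 : order_pattern pat132.
Proof. by move=> f hf x y z; rewrite /pat132 !hf. Qed.

Lemma order_pattern321 : order_pattern pat321.
Proof. by move=> f hf x y z; rewrite /pat321 !hf. Qed.

(** With the corner at 0 the insertion is the direct sum of s, 1 and t. It reaches every marked
    321-avoider because all entries before a fixed point i are smaller than i. *)
Lemma insertion321 : fixed_point_insertion pat321 (fun _ => 0).
Proof.
split=> //.
- exact: order_pattern321.
- move=> m n s t [zs slt _] [zt _ _] /avoidsP avs /avoidsP avt.
  apply/avoidsP => i j k hij hjk; rewrite size_insert => hk.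
  have ci := @nth_insert 0 0 s t i; have cj := @nth_insert 0 0 s t j.
  have ck := @nth_insert 0 0 s t k hk.
  have {ci}[] := ci (ltn_trans (ltn_trans hij hjk) hk) => -[hi ->];
  have {cj}[] := cj (ltn_trans hjk hk) => -[hj ->];
  have {ck}[] := ck => -[hk' ->]; try lia; rewrite ?subn0 /skip /=;
  have := slt i; have := avs i j k hij hjk;
  have := avt (i - (size s).+1) (j - (size s).+1) (k - (size s).+1);
  rewrite /pat321; lia.
- move=> n s i hw /avoidsP avs hi ei; exists 0; split=> // p /= hp.
  have [zs slt sinj] := hw.
  rewrite ltnNge; apply/negP => hip.
  have hpi : i < nth 0 s p.
    by rewrite ltn_neqAle hip andbT; apply/eqP => e; have := sinj p i; lia.
  (* An entry below i behind i completes a 321 with the large entry at p and with i. *)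
  have [/hasP[q]|/hasPn hn] := boolP (has (fun q => nth 0 s q < i) (iota i.+1 (n - i.+1))).
    by rewrite mem_iota => hq h; have := avs p i q; rewrite /pat321; lia.
  suff : n - i <= n - i.+1 by lia.
  (* Index i stands for p: otherwise n - i entries exceed i, while only n - i - 1 values do. *)
  apply: (@pigeonhole (fun r => if r == i then nth 0 s p else nth 0 s r) i _ i.+1)
    => [r hr|r r' hr hr'].
    case: eqP => [_|hri]; first by have := slt p; lia.
    have := hn r; rewrite mem_iota; have := slt r; have := sinj r i; lia.
  case: eqP => hri; case: eqP => hri' e; first by lia.
  + by have := sinj p r'; lia.
  + by have := sinj r p; lia.
  + by have := sinj r r'; lia.
Qed.

(* The largest a such that all of the first a entries are at least a: where
   the boundary path of the left-to-right minima crosses the diagonal. *)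
Definition corner132 (t : seq nat) :=
  find (fun a => has (fun p => nth 0 t p <= a) (iota 0 a.+1)) (iota 0 (size t)).

Lemma corner132P t :
  [/\ corner132 t <= size t,
      forall p, p < corner132 t -> corner132 t <= nth 0 t p
    & corner132 t < size t -> exists2 p, p <= corner132 t & nth 0 t p <= corner132 t].
Proof.
have hsz : corner132 t <= size t by rewrite -[size t in X in _ <= X](size_iota 0) find_size.
split=> // [p hp|hlt].
  (* The test fails at [(corner132 t).-1], where it inspects exactly the first [corner132 t]
     entries. *)
  have hb : (corner132 t).-1 < corner132 t by lia.
  have := before_find 0 hb; rewrite nth_iota; last lia.
  move/negbT/hasPn => /(_ p); rewrite mem_iota; lia.
have : has (fun a => has (fun p => nth 0 t p <= a) (iota 0 a.+1)) (iota 0 (size t)).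
  by rewrite has_find size_iota.
move/(nth_find 0); rewrite nth_iota // add0n -/(corner132 t).
case/hasP => p; rewrite mem_iota => hp h.
by exists p; lia.
Qed.

(** Of two distinct candidates, the small entry provided by the smaller one violates the lower bound
    required by the larger one. *)
Lemma corner132_unique t a : a <= size t ->
  (forall p, p < a -> a <= nth 0 t p) ->
  (a < size t -> exists2 p, p <= a & nth 0 t p <= a) -> corner132 t = a.
Proof.
move=> h1 h2 h3; have [c1 c2 c3] := corner132P t.
case: (ltngtP (corner132 t) a) => // h.
- have [|p hp hp'] := c3; first lia.
  by have := h2 p; lia.
- have [|p hp hp'] := h3; first lia.
  by have := c2 p; lia.
Qed.

Lemma insertion132 : fixed_point_insertion pat132 corner132.
Proof.
split=> //.
- exact: order_pattern132.
- by move=> t; case: (corner132P t).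
- by move=> n t p _; case: (corner132P t) => _ h _; apply: h.
- move=> m n s t [zs slt _] [zt _ tinj] /avoidsP avs /avoidsP avt.
  have [c1 c2 c3] := corner132P t; move: (corner132 t) c1 c2 c3 => a c1 c2 c3.
  (* Everything to the left of the block lies above it. *)
  have cge p : p < a -> a + size s < skip a (size s) (nth 0 t p).
    by move=> /c2; rewrite /skip; case: ifP; lia.
  have sout p := skip_outside a (size s) (nth 0 t p).
  have avt' i j k : i < j -> j < k -> k < size t ->
      ~~ pat132 (skip a (size s) (nth 0 t i)) (skip a (size s) (nth 0 t j))
                (skip a (size s) (nth 0 t k)).
    by rewrite order_pattern132; [apply: avt | apply: skip_mono].
  (* In a 132 that starts in the block and continues behind it, the first entry can be replaced by
     the small entry of t at some p <= a given by the corner; this yields a 132 in t. *)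
  have mid x j k : a <= x <= a + size s -> a <= j -> j < k -> k < size t ->
      ~~ pat132 x (skip a (size s) (nth 0 t j)) (skip a (size s) (nth 0 t k)).
    move=> hx hj hjk hk; apply/negP => /andP[h1 h2].
    rewrite skip_mono in h2.
    have h3 : a <= nth 0 t k by move: h1; rewrite /skip; case: ifP; lia.
    have [|p hp hp'] := c3; first lia.
    have hpj : p != j by apply/eqP => e; move: hp'; rewrite e; lia.
    have hpk : nth 0 t p <> nth 0 t k by move=> /tinj; lia.
    by have := avt p j k; rewrite /pat132; lia.
  apply/avoidsP => i j k hij hjk; rewrite size_insert => hk.
  have ci := @nth_insert a a s t i; have cj := @nth_insert a a s t j.
  have ck := @nth_insert a a s t k hk.
  have {ci}[] := ci (ltn_trans (ltn_trans hij hjk) hk) => -[hi ->];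
  have {cj}[] := cj (ltn_trans hjk hk) => -[hj ->];
  have {ck}[] := ck => -[hk' ->]; try lia;
  try (by apply: avt'; lia); try (by apply: mid; have := slt (i - a); lia);
  rewrite /pat132;
  have := slt (i - a); have := slt (j - a); have := slt (k - a);
  have := cge i; have := sout (k - (size s).+1);
  have := avs (i - a) (j - a) (k - a); rewrite /pat132; lia.
- move=> n s i hw /avoidsP avs hi ei; have [zs slt sinj] := hw.
  (* The block starts at the first entry not exceeding i. *)
  pose a := find (fun v => v <= i) s.
  have hbef p : p < a -> i < nth 0 s p.
    by move=> /(before_find 0)/negbT; rewrite -ltnNge.
  have hai : a <= i by rewrite leqNgt; apply/negP => /hbef; lia.
  have hsa : nth 0 s a <= i.
    by apply: (@nth_find _ 0 (fun v => v <= i)); rewrite has_find zs -/a; lia.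
  (* Otherwise the entries at a, p, i would form a 132. *)
  have hlt p : a <= p < i -> nth 0 s p < i.
    move=> hp; have := sinj a i; have := sinj p i.
    have := avs a p i; rewrite /pat132; have [->|] := eqVneq p a; lia.
  exists a; split=> // [p hp|k u v].
    rewrite hlt // andbT leqNgt; apply/negP => hv.
    have hidx w : w < n -> index w s < n /\ nth 0 s (index w s) = w.
      move=> /(word_surj hw)[q hq <-].
      have : nth 0 s q \in s by rewrite mem_nth // zs.
      by rewrite -{1}zs index_mem; split => //; apply: nth_index.
    (* Each value w with s_p <= w < i sits at a position in [a, i): before a the entries exceed i,
       and behind i it would form a 132 with s_p and i. Counting gives a <= s_p. *)
    suff : i - nth 0 s p <= i - a by lia.
    have hpi := hlt p hp.
    apply: (@pigeonhole (index^~ s) (nth 0 s p) _ a) => [w hw'|w w' hw1 hw2 e].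
      have [|h1 h2] := hidx w; first lia.
      have := hbef (index w s); have := avs p i (index w s).
      have := sinj p (index w s); rewrite h2 ei /pat132.
      by have [e|] := eqVneq (index w s) i; [rewrite e in h2 | ]; lia.
    have [|_ h1] := hidx w; first lia.
    have [|_ h2] := hidx w'; first lia.
    by rewrite -h1 -h2 e.
  have [m em] : exists m, m = i - a by exists (i - a).
  rewrite -em => wu wv es; have [zu ult _] := wu; have [zv vlt _] := wv.
  have sz : n = (m + k).+1 by rewrite -zs es size_insert zu zv.
  have hak : a <= size v by lia.
  have hge p : p < a -> a <= nth 0 v p.
    move=> hp; have := hbef p hp; rewrite es nth_insert_left //; last lia.
    by rewrite /skip zu; case: ifP; lia.
  apply: corner132_unique => // hk.
  have [/hasP[p hp h]|/hasPn hn] := boolP (has (fun p => nth 0 v p <= a) (iota 0 a.+1)).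
    by exists p => //; move: hp; rewrite mem_iota; lia.
  (* If the first a+1 entries of v all exceeded a, position i+1 of s would hold an entry above i+1,
     and the value i+1 would occur later still: a 132 starting at i. *)
  have hn' p : p <= a -> a < nth 0 v p.
    by move=> hp; have := hn p; rewrite mem_iota; lia.
  have [|q hq eq_] := @word_surj _ _ i.+1 hw; first lia.
  have e1 : nth 0 s i.+1 = skip a m (nth 0 v a).
    rewrite es -zu -(@nth_insert_right a a u v a) //; congr (nth _ _ _); lia.
  have h1 : i.+1 < nth 0 s i.+1.
    by rewrite e1 /skip; have := hn' a; case: ifP; lia.
  have hqi : i.+1 < q.
    have [hqa|hqa] := ltnP q a.
      move: eq_; rewrite es nth_insert_left //; last lia.
      by rewrite /skip zu; have := hn' q; case: ifP; lia.
    have := hlt q; have [e|] := eqVneq q i; first by rewrite e in eq_; lia.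
    by have [e|] := eqVneq q i.+1; [rewrite e in eq_ |]; lia.
  by have := avs i i.+1 q; rewrite /pat132; lia.
Qed.

(** The result is s raised by h, then the maximum, then t. Every entry in front of t exceeds all of
    t, so no 132 can start in front of t and end inside it. *)
Lemma avoids132_insert_top m h s t : is_word m s -> is_word h t ->
  avoids pat132 s -> avoids pat132 t -> avoids pat132 (insert 0 h s t).
Proof.
move=> ws wt /avoidsP avs /avoidsP avt.
have [zs slt _] := ws; have [zt tlt _] := wt.
apply/avoidsP => i j k hij hjk; rewrite size_insert => hk.
have skipE p : p < h -> skip h (size s) (nth 0 t p) = nth 0 t p.
  by move=> /tlt; rewrite /skip => ->.
have ci := @nth_insert 0 h s t i; have cj := @nth_insert 0 h s t j.
have ck := @nth_insert 0 h s t k hk.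
have {ci}[] := ci (ltn_trans (ltn_trans hij hjk) hk) => -[ei ->];
have {cj}[] := cj (ltn_trans hjk hk) => -[ej ->];
have {ck}[] := ck => -[ek' ->]; try lia; rewrite ?subn0 ?skipE; try lia;
have := avs i j k hij hjk;
have := avt (i - (size s).+1) (j - (size s).+1) (k - (size s).+1);
have := slt i; have := slt j; have := slt k;
have := tlt (i - (size s).+1); have := tlt (j - (size s).+1); have := tlt (k - (size s).+1);
rewrite /pat132; lia.
Qed.

(* Decompose at the maximum. *)
Lemma size_avoiders132 n :
  size (avoiders pat132 n.+1) =
  \sum_(0 <= m < n.+1) size (avoiders pat132 m) * size (avoiders pat132 (n - m)).
Proof.
under eq_bigr => m _ do rewrite -size_pairs.
apply: (size_dep_bij (f := fun m x => insert 0 (n - m) x.1 x.2)).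
- exact: avoiders_uniq.
- exact: iota_uniq.
- move=> m _; apply: allpairs_uniq; [exact: avoiders_uniq.. | ].
  by move=> [? ?] [? ?] _ _ [-> ->].
- move=> m; rewrite mem_index_iota => hm _ /allpairsP[[s t] /= [hs ht ->]] /=.
  move: hs ht => /avoidersP[ws avs] /avoidersP[wt avt].
  apply/avoidersP; split.
    have -> : n.+1 = (m + (n - m)).+1 by lia.
    exact: insert_word.
  exact: (avoids132_insert_top ws wt).
- move=> i j; rewrite !mem_index_iota => hi hj x y /allpairsP[[s t] /= [hs ht ->]].
  move=> /allpairsP[[s' t'] /= [hs' ht' ->]] /= e.
  move: hs ht hs' ht' => /avoidersP[ws _] /avoidersP[wt _] /avoidersP[ws' _] /avoidersP[wt' _].
  have [zs _ _] := ws; have [zt _ _] := wt; have [zs' _ _] := ws'; have [zt' _ _] := wt'.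
  (* Both indices are the position of the maximum n. *)
  have eij : i = j.
    have [|_ _ winj] := @insert_word 0 (n - j) _ _ _ _ ws' wt' isT; first by [].
    apply: winj; try lia.
    have := @nth_insert_last 0 (n - i) s t isT; rewrite zs add0n -e => ->.
    have := @nth_insert_last 0 (n - j) s' t' isT; rewrite zs' add0n -e => ->.
    lia.
  rewrite -eij in zs' zt' e *.
  by have [||| -> ->] := insert_inj _ _ _ e; rewrite ?zs ?zt.
- move=> s /avoidersP[hw avs']; have /avoidsP avs := avs'.
  have [zs slt sinj] := hw.
  have [m hm em] := word_surj hw (ltnSn n).
  have hbox p : 0 <= p < 0 + m -> n - m <= nth 0 s p < n - m + m.
    move=> hp; have hpn : nth 0 s p < n by have := slt p; have := sinj p m; lia.
    suff : n - m <= nth 0 s p by lia.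
    (* The n - m entries behind the maximum are all below s_p, since a larger one would complete a
       132 with s_p and the maximum. *)
    apply: (@pigeonhole (nth 0 s) m.+1 _ 0) => [q hq|q q' hq hq' e].
      have := avs p m q; have := sinj p q; have := slt q; have := sinj q m.
      rewrite /pat132; lia.
    by have := sinj q q'; lia.
  have [||u [v [wu wv es]]] := @insert_decomp n.+1 s 0 (n - m) m hw _ hbox.
  - by [].
  - by rewrite add0n em subnK.
  rewrite es in avs'.
  have [au av] := insert_avoids order_pattern132 (leq0n _) avs'.
  exists m, (u, v); split=> //; first by rewrite mem_index_iota; lia.
  by apply/allpairsP; exists (u, v); split=> //; apply/avoidersP.
Qed.

(** * Counting 321-avoiders *)

Definition tail_increasing j (s : seq nat) :=
  all (fun q => all (fun p => nth 0 s p < nth 0 s q)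
                    (iota (size s - j) (q - (size s - j))))
      (iota 0 (size s)).

Lemma tail_increasingP j s :
  reflect (forall p q, size s - j <= p -> p < q -> q < size s ->
             nth 0 s p < nth 0 s q)
          (tail_increasing j s).
Proof.
apply: (iffP idP) => [/allP h p q hp hpq hq|h].
  have /allP/(_ p) := h q ltac:(by rewrite mem_iota).
  by apply; rewrite mem_iota; lia.
apply/allP => q; rewrite mem_iota => hq.
by apply/allP => p; rewrite mem_iota => hp; apply: h; lia.
Qed.

(** The tail parameter makes removal of the maximum recursive, since it records where a new maximum
    may be inserted. *)
Definition tail_avoiders n j := [seq s <- avoiders pat321 n | tail_increasing j s].

Lemma tail_avoidersP n j s :
  reflect [/\ is_word n s, avoids pat321 s & tail_increasing j s]
          (s \in tail_avoiders n j).
Proof.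
rewrite mem_filter; apply: (iffP andP) => [[h /avoidersP[]]|[h1 h2 h3]] //.
by split=> //; apply/avoidersP.
Qed.

Lemma tail_avoiders_uniq n j : uniq (tail_avoiders n j).
Proof. exact/filter_uniq/avoiders_uniq. Qed.

Lemma nth_insert_max n a t p : is_word n t -> p < n.+1 ->
  let v := nth 0 (insert a n [::] t) p in
  [\/ p < a /\ (p < n -> v = nth 0 t p), p = a /\ v = n
    | a < p /\ v = nth 0 t p.-1].
Proof.
move=> [zt tlt _] hp; have := @nth_insert a n [::] t p; rewrite zt => /(_ hp).
move=> /= [] [h ->]; rewrite /= ?addn0 in h *.
- by constructor 1; split=> // /tlt; rewrite /skip => ->.
- lia.
- by constructor 2.
- by constructor 3; split=> //; rewrite /skip subn1 tlt //; lia.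
Qed.

(** The new maximum can only be the first entry of a 321, and the h entries behind it increase. *)
Lemma avoids321_insert_max n l h t : is_word n t -> avoids pat321 t ->
  tail_increasing l t -> h <= l -> l <= n -> avoids pat321 (insert (n - h) n [::] t).
Proof.
move=> wt /avoidsP avt /tail_increasingP ht hh hl; have [zt tlt _] := wt.
apply/avoidsP => i j k hij hjk; rewrite size_insert zt /= add0n => hk.
have ci := @nth_insert_max n (n - h) t i wt; have cj := @nth_insert_max n (n - h) t j wt.
have ck := @nth_insert_max n (n - h) t k wt hk.
have hi' : i < n.+1 by lia.
have hj' : j < n.+1 by lia.
move: (nth 0 (insert _ _ _ _)) ci cj ck => v /(_ hi') /= ci /(_ hj') /= cj /= ck.
case: ci => -[ei vi]; case: cj => -[ej vj]; case: ck => -[ek vk]; try lia; rewrite /pat321.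
- by have := avt i j k; rewrite /pat321; lia.
- by have := tlt j; lia.
- by have := avt i j k.-1; rewrite /pat321; lia.
- by have := tlt i; lia.
- by have := avt i j.-1 k.-1; rewrite /pat321; lia.
- by have := ht j.-1 k.-1; lia.
- by have := avt i.-1 j.-1 k.-1; rewrite /pat321; lia.
Qed.

(** A maximum put last extends the increasing tail by one; put in front of the last l >= j entries,
    it leaves the last j untouched. *)
Lemma tail_increasing_insert_max n l j h t : is_word n t -> tail_increasing l t ->
  j <= n.+1 -> l <= n -> (h = 0 /\ l = j.-1 \/ h = l /\ j <= l) ->
  tail_increasing j (insert (n - h) n [::] t).
Proof.
move=> wt /tail_increasingP ht hj hl hh; have [zt tlt _] := wt.
apply/tail_increasingP => p q; rewrite size_insert zt /= add0n => hp hpq hq.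
have cp := @nth_insert_max n (n - h) t p wt; have cq := @nth_insert_max n (n - h) t q wt hq.
have hp' : p < n.+1 by lia.
have := tlt p; have := ht p q; have := ht p.-1 q.-1; rewrite zt.
move: (nth 0 (insert _ _ _ _)) cp cq => v /(_ hp') /= cp /= cq.
by case: cp => -[ep vp]; case: cq => -[eq_ vq]; case: hh => -[h1 h2]; lia.
Qed.

(* Remove the maximum: if it is not last, the entries after it increase, so
   it lies in front of the increasing tail. *)
Lemma tail_avoiders_decomp n j s : j <= n.+1 -> s \in tail_avoiders n.+1 j ->
  exists l t, [/\ j.-1 <= l < n.+1, t \in tail_avoiders n l
    & s = insert (n - (if l == j.-1 then 0 else l)) n [::] t].
Proof.
move=> hj /tail_avoidersP[ws av hs]; have /avoidsP avs := av.
have [zs slt sinj] := ws; have /tail_increasingP ts := hs; rewrite zs in ts.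
have [P hP eP] := word_surj ws (ltnSn n).
have [|||u [t [wu wt es]]] := @insert_decomp n.+1 s P n 0 ws; try by rewrite ?addn0; lia.
have eu : u = [::] by apply: size0nil; case: wu.
rewrite {}eu /= subn0 in wt es.
have [zt tlt tinj] := wt.
have hPt : P <= size t by rewrite zt.
have avi : avoids pat321 (insert P n [::] t) by rewrite -es.
have [_ avt] := insert_avoids order_pattern321 hPt avi.
have tE p : p < n -> nth 0 t p = nth 0 s (if p < P then p else p.+1).
  move=> hp; have hr := @nth_insert_max n P t _ wt; case: ifP => hpP.
    by have := hr p; rewrite -es => -[]; lia.
  by have := hr p.+1 hp; rewrite -es /= => -[]; lia.
have [hPn|hPn] := eqVneq P n.
  rewrite hPn in es.
  exists j.-1, t; rewrite eqxx subn0; split=> //; first lia.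
  apply/tail_avoidersP; split=> //; apply/tail_increasingP => p q; rewrite zt => hp hpq hq.
  rewrite !tE; try lia; rewrite !ifT; try lia.
  by apply: ts; lia.
have hjP : j <= n - P.
  have := ts P P.+1; have := slt P.+1; lia.
exists (n - P), t; rewrite ifN; last lia.
have -> : n - (n - P) = P by lia.
split=> //; first lia.
apply/tail_avoidersP; split=> //; apply/tail_increasingP => p q; rewrite zt => hp hpq hq.
rewrite !tE; try lia; rewrite !ifN; try lia.
have := avs P p.+1 q.+1; have := sinj p.+1 q.+1; have := sinj P p.+1; have := slt p.+1.
rewrite /pat321; lia.
Qed.

(** The term l = j.-1 stands for words with the maximum last, which leaves a tail of length j.-1 to
    be increasing. A term l > j.-1 stands for words with exactly l entries behind the maximum, and
    these increase. *)
Lemma size_tail_avoidersS n j : j <= n.+1 ->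
  size (tail_avoiders n.+1 j) = \sum_(j.-1 <= l < n.+1) size (tail_avoiders n l).
Proof.
move=> hj; pose h l := if l == j.-1 then 0 else l.
have h_le l : h l <= l by rewrite /h; case: ifP.
apply: (size_dep_bij (f := fun l t => insert (n - h l) n [::] t)).
- exact: tail_avoiders_uniq.
- exact: iota_uniq.
- by move=> l _; apply: tail_avoiders_uniq.
- move=> l; rewrite mem_index_iota => hl t /tail_avoidersP[wt avt ht].
  have [zt _ _] := wt.
  apply/tail_avoidersP; split.
  + by apply: (@insert_word _ _ 0 n) => //; lia.
  + by apply: avoids321_insert_max ht _ _ => //; lia.
  + apply: (tail_increasing_insert_max wt ht) => //; first lia.
    by rewrite /h; case: eqP; lia.
- move=> l l'; rewrite !mem_index_iota => hl hl' t t' /tail_avoidersP[wt _ _].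
  move=> /tail_avoidersP[wt' _ _] e; have [zt _ _] := wt; have [zt' _ _] := wt'.
  have h1 := h_le l; have h2 := h_le l'.
  have eh : n - h l = n - h l'.
    have [|||_ _ winj] := @insert_word (n - h l') n 0 n [::] _ _ wt'; try by [|lia].
    apply: winj; try lia.
    have := @nth_insert_last (n - h l) n [::] t; rewrite addn0 e zt => -> //; last lia.
    have := @nth_insert_last (n - h l') n [::] t'; rewrite addn0 zt' => -> //; lia.
  have ell : l = l' by move: eh; rewrite /h; do 2?case: ifP; lia.
  split=> //; rewrite -eh in e.
  by have [||| _ ->] := insert_inj _ _ _ e; rewrite ?zt ?zt' //; lia.
- move=> s hs; have [l [t [h1 h2 h3]]] := tail_avoiders_decomp hj hs.
  by exists l, t; split=> //; rewrite mem_index_iota.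
Qed.

Lemma size_tail_avoiders n j : j <= n ->
  ((size (tail_avoiders n j))%:R = ballot n j)%R.
Proof.
elim: n j => [|n IH] j hj.
  by have -> : j = 0 by lia.
rewrite size_tail_avoidersS // ballot_sum // natr_sum.
by apply: eq_big_nat => l hl; apply: IH; lia.
Qed.

Lemma catalan_avoiders321 n : ((size (avoiders pat321 n))%:R = catalan n)%R.
Proof.
rewrite -ballotn0 -size_tail_avoiders //; congr (size _)%:R%R.
rewrite /tail_avoiders -[LHS]filter_predT; apply: eq_in_filter => s /avoidersP[[zs _ _] _].
by apply/esym/tail_increasingP => p q; lia.
Qed.

Lemma catalan_avoiders132 n : ((size (avoiders pat132 n))%:R = catalan n)%R.
Proof.
have [m] := ubnP n; elim: m n => // m IH [|n] hn; first by rewrite catalan0.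
rewrite size_avoiders132 -catalan_conv /conv natr_sum big_mkord.
by apply: eq_bigr => -[i hi] _ /=; rewrite natrM !IH //; lia.
Qed.

Lemma size_one_fixed_avoiders_formula R corner n : fixed_point_insertion R corner ->
  (forall n, (size (avoiders R n))%:R = catalan n)%R ->
  ((size (one_fixed_avoiders R n.+1))%:R =
   1 / 4%:R * \sum_(0 <= i < n.+1)
    (- 1 / 2%:R) ^+ i * (catalan (n.+1 - i) + 3%:R * fine_number (n.+1 - i - 1)) :> rat)%R.
Proof.
move=> hR hc; rewrite -conv_fine_formula.
have hd : (fun n => (size (avoiding_derangements R n))%:R%R) =1 fine_number.
  apply: (@derangements_fine _ (fun n => (size (avoiders R n))%:R%R)) => // k.
  rewrite (size_avoiders_rec hR) natrD natr_sum big_mkord; congr (_ + _)%R.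
  by apply: eq_bigr => i _; rewrite natrM.
rewrite (size_one_fixed_avoiders hR) natr_sum big_mkord.
by apply: eq_bigr => i _; rewrite natrM !hd.
Qed.

(** * From words to permutations *)

Definition revcomp (s : seq nat) :=
  mkseq (fun p => (size s).-1 - nth 0 s ((size s).-1 - p)) (size s).

Lemma revcomp_word n s : is_word n s -> is_word n (revcomp s).
Proof.
move=> [zs slt sinj]; split=> [|p hp|p q hp hq]; first by rewrite size_mkseq.
  by rewrite nth_mkseq zs //; lia.
rewrite !nth_mkseq zs // => e.
have := slt (n.-1 - p); have := slt (n.-1 - q); have := sinj (n.-1 - p) (n.-1 - q); lia.
Qed.

Lemma revcompK n s : is_word n s -> revcomp (revcomp s) = s.
Proof.
move=> [zs slt _]; have z : size (revcomp s) = n by rewrite size_mkseq.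
apply: (@eq_from_nth _ 0); rewrite !size_mkseq // zs => p hp.
rewrite nth_mkseq z // nth_mkseq zs; last lia.
have -> : n.-1 - (n.-1 - p) = p by lia.
by have := slt p hp; lia.
Qed.

(** Reverse-complement is an involution on words and moves a fixed point p to n-1-p. The triple in
    the hypothesis is reversed because the positions are. Applying the inequality both ways gives
    equality. *)
Lemma leq_size_revcomp (R R' : nat -> nat -> nat -> bool) n :
  (forall c x y z, x <= c -> y <= c -> z <= c ->
     R' (c - z) (c - y) (c - x) = R x y z) ->
  size (one_fixed_avoiders R n) <= size (one_fixed_avoiders R' n).
Proof.
move=> hR; rewrite -(size_map revcomp); apply: uniq_leq_size.
  rewrite map_inj_in_uniq; first exact/filter_uniq/avoiders_uniq.
  move=> s t; rewrite [s \in _]mem_filter [t \in _]mem_filter.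
  move=> /andP[_ /avoidersP[ws _]] /andP[_ /avoidersP[wt _]] e.
  by rewrite -(revcompK ws) e (revcompK wt).
move=> _ /mapP[s hs ->]; move: hs; rewrite mem_filter => /andP[].
move=> /one_fixed_pointP[p [hp ep] hu] /avoidersP[ws /avoidsP avs].
have [zs slt _] := ws; rewrite zs in hp hu avs.
rewrite mem_filter; apply/andP; split.
  apply/one_fixed_pointP; exists (n.-1 - p); rewrite size_mkseq zs.
    rewrite nth_mkseq zs; last lia.
    have -> : n.-1 - (n.-1 - p) = p by lia.
    by rewrite ep; lia.
  move=> q hq; rewrite nth_mkseq zs // => e.
  by have := hu (n.-1 - q); have := slt (n.-1 - q); lia.
apply/avoidersP; split; first exact: revcomp_word.
apply/avoidsP => i j k hij hjk; rewrite size_mkseq zs => hk.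
have hi : i < n by lia.
have hj : j < n by lia.
have hle q : q < n -> nth 0 s q <= n.-1 by move=> /slt; lia.
by rewrite !nth_mkseq zs // hR ?hle //; try lia; apply: avs; lia.
Qed.

Definition pat213 (x y z : nat) := (y < x) && (x < z).

Lemma size_one_fixed_avoiders213 n :
  size (one_fixed_avoiders pat213 n) = size (one_fixed_avoiders pat132 n).
Proof.
apply/eqP; rewrite eqn_leq !leq_size_revcomp // => c x y z; rewrite /pat132 /pat213; lia.
Qed.

(** * One-line notation of elements of ['S_n] *)

Definition word n (pi : 'S_n) : seq nat := [seq (pi i : nat) | i <- enum 'I_n].

Lemma size_word n (pi : 'S_n) : size (word pi) = n.
Proof. by rewrite size_map size_enum_ord. Qed.

Lemma nth_word n (pi : 'S_n) (i : 'I_n) : nth 0 (word pi) i = pi i.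
Proof. by rewrite (nth_map i) ?size_enum_ord // nth_ord_enum. Qed.

Lemma word_inj n : injective (@word n).
Proof.
move=> pi pi' e; apply/permP => i; apply: val_inj => /=.
by rewrite -!nth_word e.
Qed.

Lemma word_is_word n (pi : 'S_n) : is_word n (word pi).
Proof.
split=> [|p hp|p q hp hq]; first exact: size_word.
  by rewrite (nth_word pi (Ordinal hp)).
rewrite (nth_word pi (Ordinal hp)) (nth_word pi (Ordinal hq)).
by move/val_inj/perm_inj/(congr1 val).
Qed.

Lemma word_onto n s : is_word n s -> exists pi : 'S_n, s = word pi.
Proof.
move=> [zs slt sinj]; pose f (i : 'I_n) := Ordinal (slt i (ltn_ord i)).
have finj : injective f by move=> i j /(congr1 val) /= /sinj e; apply/val_inj/e.
exists (perm finj); apply: (@eq_from_nth _ 0); rewrite ?size_word // zs => p hp.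
by rewrite (nth_word _ (Ordinal hp)) permE.
Qed.

Lemma avoids3_word n alpha R (pi : 'S_n) :
  (forall x y z, order_iso [:: x; y; z] alpha = R x y z) ->
  avoids3 alpha pi = avoids R (word pi).
Proof.
move=> hR; apply/idP/avoidsP => [/existsPn h i j k hij hjk|h].
  rewrite size_word => hk.
  have hj := ltn_trans hjk hk; have hi := ltn_trans hij hj.
  have /existsPn/(_ (Ordinal hj))/existsPn/(_ (Ordinal hk)) := h (Ordinal hi).
  rewrite hR /= hij hjk /= -!nth_word; exact.
apply/existsPn => i; apply/existsPn => j; apply/existsPn => k.
apply/and3P => -[hij hjk]; rewrite hR -!nth_word.
by apply/negP/h; rewrite ?size_word.
Qed.

Lemma card_fixed_points_word n (pi : 'S_n) :
  (#|fixed_points pi| == 1) = one_fixed_point (word pi).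
Proof.
rewrite /one_fixed_point size_word -val_enum_ord count_map cardsE cardE size_filter.
congr (_ == 1); rewrite -enumT; apply: eq_count => i /=.
by rewrite nth_word.
Qed.

Lemma num_avoid_fix_words n alpha R :
  (forall x y z, order_iso [:: x; y; z] alpha = R x y z) ->
  num_avoid_fix n 1 alpha = size (one_fixed_avoiders R n).
Proof.
move=> hR; rewrite /num_avoid_fix cardE -(size_map (@word n)).
apply/perm_size/uniq_perm.
- by rewrite map_inj_uniq ?enum_uniq //; apply: word_inj.
- exact/filter_uniq/avoiders_uniq.
move=> s; rewrite [RHS]mem_filter; apply/mapP/andP => [[pi hpi ->]|[h1 /avoidersP[ws av]]].
  move: hpi; rewrite mem_enum inE (avoids3_word _ hR) card_fixed_points_word.
  move=> /andP[h1 h2]; split=> //; apply/avoidersP; split=> //; exact: word_is_word.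
have [pi epi] := word_onto ws; exists pi => //.
by rewrite mem_enum inE (avoids3_word _ hR) card_fixed_points_word -epi av.
Qed.

(** Of the nine comparisons the three diagonal ones hold trivially. Both directions of each pair are
    kept, as the naturals x, y, z may coincide. *)
Lemma order_iso3 x y z a b c :
  order_iso [:: x; y; z] [:: a; b; c] =
  [&& (x < y) == (a < b), (x < z) == (a < c), (y < x) == (b < a),
      (y < z) == (b < c), (z < x) == (c < a) & (z < y) == (c < b)].
Proof.
rewrite /order_iso /=; apply/forallP/idP => [h|/and5P[h1 h2 h3 h4 /andP[h5 h6]] i].
  pose o0 : 'I_3 := @Ordinal 3 0 isT.
  pose o1 : 'I_3 := @Ordinal 3 1 isT.
  pose o2 : 'I_3 := @Ordinal 3 2 isT.
  by apply/and5P; split; last (apply/andP; split);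
    [ have /forallP/(_ o1) := h o0 | have /forallP/(_ o2) := h o0
    | have /forallP/(_ o0) := h o1 | have /forallP/(_ o2) := h o1
    | have /forallP/(_ o0) := h o2 | have /forallP/(_ o1) := h o2].
apply/forallP => j.
by case: i j => [[|[|[|i]]] hi] // [[|[|[|j]]] hj] //=; rewrite !ltnn.
Qed.

Theorem theorem7p3 (alpha : seq nat)
    (halpha : alpha \in [:: [:: 1; 3; 2]; [:: 3; 2; 1]; [:: 2; 1; 3]])
    (n : nat) (hn : 1 <= n) :
  ((num_avoid_fix n 1 alpha)%:R =
     1 / 4%:R *
     \sum_(0 <= i < n)
        (- 1 / 2%:R) ^+ i * (catalan (n - i) + 3%:R * fine_number (n - i - 1))
   :> rat)%R.
Proof.
case: n hn => // n _.
have f132 := size_one_fixed_avoiders_formula n insertion132 catalan_avoiders132.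
have f321 := size_one_fixed_avoiders_formula n insertion321 catalan_avoiders321.
move: halpha; rewrite !inE => /or3P[] /eqP ->.
- rewrite -f132 (@num_avoid_fix_words _ _ pat132) // => x y z.
  by rewrite order_iso3 /pat132; lia.
- rewrite -f321 (@num_avoid_fix_words _ _ pat321) // => x y z.
  by rewrite order_iso3 /pat321; lia.
- rewrite -f132 -size_one_fixed_avoiders213 (@num_avoid_fix_words _ _ pat213) // => x y z.
  by rewrite order_iso3 /pat213; lia.
Qed.
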